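(* For $H\in\mathbb{R}^{m\times\nu}$ let $$ \mathfrak{R}[H]=\min_{\lambda_\ell,\mu^\ell,\kappa^\ell,\varkappa^\ell,\rho,\varrho}\Big\{\big[1+\sqrt{2\ln(2L/\epsilon)}\big]\Big[\sigma\max_{\ell\le L}\|HR_\ell^{1/2}\|_{\mathrm{Fro}}+\rho\Big]+\varrho\Big\}, $$ the minimum being over real $\rho,\varrho$ and, for $\ell=1,\dots,L$, real $\lambda_\ell,\kappa^\ell$ and vectors $\mu^\ell,\varkappa^\ell\in\mathbb{R}^K$, subject to, for all $\ell\le L$: $\mu^\ell\ge0$, $\varkappa^\ell\ge0$, $\lambda_\ell+\phi_{\mathcal T}(\mu^\ell)\le\rho$, $\kappa^\ell+\phi_{\mathcal T}(\varkappa^\ell)\le\varrho$, $$ \begin{bmatrix}\lambda_\ell I_{\nu q}&\tfrac12[R_\ell^{1/2}H^TA_1;\dots;R_\ell^{1/2}H^TA_q]\\ \tfrac12[A_1^THR_\ell^{1/2},\dots,A_q^THR_\ell^{1/2}]&\sum_{k=1}^K\mu^\ell_kT_k\end{bmatrix}\succeq0, $$ $$ \begin{bmatrix}\kappa^\ell I_\nu&\tfrac12R_\ell^{1/2}[B-H^TA]\\ \tfrac12[B-H^TA]^TR_\ell^{1/2}&\sum_{k=1}^K\varkappa^\ell_kT_k\end{bmatrix}\succeq0 . $$ Then $\min_{H\in\mathbb{R}^{m\times\nu}}\mathfrak R[H]$ is a convex optimization problem (i.e. $\mathfrak R$ is a convex function of $H$), and for every $H\in\mathbb{R}^{m\times\nu}$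 the $\epsilon$-risk of the linear estimate $\widehat w^H_{\rm lin}(\omega)=H^T\omega$ satisfies $$\mathrm{Risk}_\epsilon[\widehat w^H_{\rm lin}|\mathcal X]\le\mathfrak R[H].$$
   Context: Notation: $\mathbf S^d$ is the space of symmetric $d\times d$ matrices, $\mathbf S^d_+$ the positive semidefinite ones, $\succeq$ the semidefinite order; $[M_1;\dots;M_q]$ is vertical and $[M_1,\dots,M_q]$ horizontal concatenation; $\|\cdot\|_{\mathrm{Fro}}$ is the Frobenius norm; $\phi_{\mathcal T}(y)=\sup_{u\in\mathcal T}y^Tu$. Observation model: $\omega=A[\eta]x+\xi\in\mathbb{R}^m$ with $A[\eta]=A+\sum_{\alpha=1}^q\eta_\alpha A_\alpha$, where $A,A_1,\dots,A_q\in\mathbb{R}^{m\times n}$ are given. The unknown signal $x$ belongs to $\mathcal X\subset\mathbb R^n$, and one wants to recover $w=Bx$, $B\in\mathbb{R}^{\nu\times n}$ given. The noise $\xi$ and the perturbation $\eta$ are random vectors which are zero-mean sub-Gaussian: $\mathbf E\{e^{t^T\xi}\}\le\exp(\tfrac{\sigma^2}{2}\|t\|_2^2)$ for all $t\in\mathbb{R}^m$ (with given $\sigma>0$) and $\mathbf E\{e^{t^T\eta}\}\le\exp(\tfrac12\|t\|_2^2)$ for all $t\in\mathbb{R}^q$. Recovery error is measured in the norm $\|u\|=\max_{\ell\le L}\sqrt{u^TR_\ell u}$ on $\mathbb{R}^\nu$, where $R_\ell\in\mathbf S^\nu_+$ and $\sum_{\ell}R_\ell\succ0$. The signal set is a basic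 ellitope: $\mathcal X=\{x\in\mathbb{R}^n:\exists t\in\mathcal T:\ x^TT_kx\le t_k,\ k\le K\}$, where $T_k\in\mathbf S^n_+$, $\sum_kT_k\succ0$, and $\mathcal T\subset\mathbb{R}^K_+$ is a convex compact set with nonempty interior which is monotone: $0\le t'\le t\in\mathcal T$ implies $t'\in\mathcal T$. Given $\epsilon\in(0,1)$, the $\epsilon$-risk of an estimate $\widehat w(\cdot)$ is $$\mathrm{Risk}_\epsilon[\widehat w|\mathcal X]=\sup_{x\in\mathcal X}\inf\{\rho:\ \mathrm{Prob}_{\xi,\eta}\{\|Bx-\widehat w(A[\eta]x+\xi)\|>\rho\}\le\epsilon\}.$$ *)

(* Defs.v *)
From HB Require Import structures.
From mathcomp Require Import all_boot all_order all_algebra.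
From mathcomp Require Import all_classical all_reals all_analysis.

Set Implicit Arguments.
Unset Strict Implicit.
Unset Printing Implicit Defensive.

Import Order.TTheory GRing.Theory Num.Theory.
Import numFieldNormedType.Exports.

Local Open Scope classical_set_scope.
Local Open Scope ring_scope.

Section Matrices.
Context {R : realType}.

Definition dot {k} (u v : 'cV[R]_k) : R := (u^T *m v) 0 0.

Definition qform {k} (M : 'M[R]_k) (u : 'cV[R]_k) : R := (u^T *m M *m u) 0 0.

Definition psdmx {k} (M : 'M[R]_k) : Prop :=
  M \is symmetricmx /\ forall u, 0 <= qform M u.

Definition pdmx {k} (M : 'M[R]_k) : Prop :=
  M \is symmetricmx /\ forall u, u != 0 -> 0 < qform M u.

(* The positive semidefinite square root; it exists and is unique when M is
   positive semidefinite. *)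
Definition sqrtmx {k} (M : 'M[R]_k) : 'M[R]_k :=
  xget 0 [set S | psdmx S /\ S *m S = M].

Definition frob_norm {k l} (M : 'M[R]_(k, l)) : R :=
  Num.sqrt (\sum_i \sum_j M i j ^+ 2).

Definition nonneg_vec {k} (u : 'cV[R]_k) : Prop := forall i, 0 <= u i 0.

Definition support_fun {k} (T : set 'cV[R]_k) (y : 'cV[R]_k) : R :=
  sup [set dot y u | u in T].

(* The maximands are nonnegative, so starting the maximum at 0 is harmless. *)
Definition maxnorm {L nu} (Rl : 'I_L -> 'M[R]_nu) (u : 'cV[R]_nu) : R :=
  \big[Num.max/0]_(l < L) Num.sqrt (qform (Rl l) u).

Definition ellitope {n K} (Tk : 'I_K -> 'M[R]_n) (T : set 'cV[R]_K)
    : set 'cV[R]_n :=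
  [set x | exists2 t, T t & forall k, qform (Tk k) x <= t k 0].

Definition perturbed_mx {m n q} (A : 'M[R]_(m, n))
    (dA : 'I_q -> 'M[R]_(m, n)) (eta : 'cV[R]_q) : 'M[R]_(m, n) :=
  A + \sum_(a < q) eta a 0 *: dA a.

End Matrices.

Section Probability.
Local Open Scope ereal_scope.
Context {R : realType} {d : measure_display} {Omega : measurableType d}
  (P : probability Omega R).

Definition rvec {k} (X : 'I_k -> {RV P >-> R}) (w : Omega) : 'cV[R]_k :=
  (\col_i X i w)%R.

Definition zero_mean_subgaussian {k} (s : R) (X : 'I_k -> {RV P >-> R})
    : Prop :=
  (forall i, 'E_P[X i] = 0) /\
  forall t : 'cV[R]_k,
    'E_P[fun w => expR (dot t (rvec X w))] <=
      (expR (s ^+ 2 / 2 * dot t t))%:E.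

(* [obs x w] is the observation of the signal x at the outcome w. *)
Definition eps_risk {m n nu} (nrm : 'cV[R]_nu -> R) (eps : R)
    (X : set 'cV[R]_n) (B : 'M[R]_(nu, n))
    (obs : 'cV[R]_n -> Omega -> 'cV[R]_m) (what : 'cV[R]_m -> 'cV[R]_nu)
    : \bar R :=
  ereal_sup
    [set ereal_inf
           [set rho%:E | rho in
             [set rho | P [set w | (rho < nrm (B *m x - what (obs x w)))%R]
                        <= eps%:E]]
    | x in X].

End Probability.

Section RiskBound.
Context {R : realType} {m n nu q L K : nat}.
Variables (A : 'M[R]_(m, n)) (dA : 'I_q -> 'M[R]_(m, n)) (B : 'M[R]_(nu, n)).
Variables (Rl : 'I_L -> 'M[R]_nu) (Tk : 'I_K -> 'M[R]_n) (T : set 'cV[R]_K).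
Variables (sigma eps : R).
Implicit Types (H : 'M[R]_(m, nu)).


(* The index \sum_(a < q) nu, imposed by \mxcol and \mxrow, is nu * q. *)
Definition perturbation_lmi H (l : 'I_L) (lambda : R) (mu : 'cV[R]_K)
    : 'M[R]_((\sum_(a < q) nu) + n) :=
  block_mx
    lambda%:M
    (2^-1 *: \mxcol_(a < q) (sqrtmx (Rl l) *m H^T *m dA a))
    (2^-1 *: \mxrow_(a < q) ((dA a)^T *m H *m sqrtmx (Rl l)))
    (\sum_(k < K) mu k 0 *: Tk k).

Definition bias_lmi H (l : 'I_L) (kappa : R) (chi : 'cV[R]_K)
    : 'M[R]_(nu + n) :=
  block_mx
    kappa%:M
    (2^-1 *: (sqrtmx (Rl l) *m (B - H^T *m A)))
    (2^-1 *: ((B - H^T *m A)^T *m sqrtmx (Rl l)))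
    (\sum_(k < K) chi k 0 *: Tk k).

Definition feasible H (lambda kappa : 'I_L -> R) (mu chi : 'I_L -> 'cV[R]_K)
    (rho varrho : R) : Prop :=
  forall l : 'I_L,
    [/\ nonneg_vec (mu l) /\ nonneg_vec (chi l),
        lambda l + support_fun T (mu l) <= rho,
        kappa l + support_fun T (chi l) <= varrho,
        psdmx (perturbation_lmi H l (lambda l) (mu l)) &
        psdmx (bias_lmi H l (kappa l) (chi l))].

Definition objective H (rho varrho : R) : R :=
  (1 + Num.sqrt (2 * ln (2 * L%:R / eps))) *
    (sigma * \big[Num.max/0]_(l < L) frob_norm (H *m sqrtmx (Rl l)) + rho)
  + varrho.

Definition objective_values H : set R :=
  [set v | exists lambda kappa mu chi rho varrho,
     feasible H lambda kappa mu chi rho varrho /\ v = objective H rho varrho].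

Definition risk_bound H : R := inf (objective_values H).

End RiskBound.

(* Main.v *)
(* Multiplying the error of [H^T omega] by [R_l^(1/2)] splits it into a bias
   term, a term linear in [eta] and a term linear in [xi].  Each matrix inequality,
   tested on a suitable unit vector, bounds the Euclidean norm of its matrix
   applied to [x] by [varrho] (resp. [rho]).  The two random terms are
   controlled by the tail bound
     [P (|M zeta| > (1 + sqrt (2 ln (1/delta))) |M|_Fro) <= delta]
   for sub-Gaussian [zeta], taken with [delta = eps / (2 L)]; a union bound over
   the [2 L] events needs no independence of [xi] and [eta].

   For the tail bound, Jensen's inequality with weights the squared row norms of
   [M] reduces [E exp (s |M zeta|^2 / 2)], [|M|_Fro = 1], to the scalar estimate
   [E exp (s Y^2 / 2) <= (1 - s)^(-1/2)], and Markov's inequality is used with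
   [s = 1 - (1 + r)^(-2)], [r = sqrt (2 ln (1/delta))].

   The minimum is attained because the constraints on [(rho, lambda, mu)] are
   affine inequalities, an interior point of [T] bounds [mu] by [rho], and
   positive definiteness of [sum_k T_k] makes them consistent. *)

Require Import Defs.
From mathcomp Require Import all_boot all_order all_algebra.
From mathcomp Require Import all_classical all_reals all_analysis.
From mathcomp Require Import measurable_realfun complex ring lra.

Set Implicit Arguments.
Unset Strict Implicit.
Unset Printing Implicit Defensive.

Import Order.TTheory GRing.Theory Num.Theory.
Import numFieldNormedType.Exports.

Local Open Scope classical_set_scope.
Local Open Scope ring_scope.

(** * Euclidean norms and quadratic forms *)

Section EuclideanNorm.
Context {R : realType}.

(** The sum of the squares [(b * x i - a * y i) ^+ 2] equals [b * (X * b - a ^+ 2)] and is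
    nonnegative. Dividing by [b] gives the claim, and [b = 0] forces [y = 0]. *)
Lemma sum_CauchySchwarz (I : finType) (x y : I -> R) :
  (\sum_i x i * y i) ^+ 2 <= (\sum_i x i ^+ 2) * (\sum_i y i ^+ 2).
Proof.
set a := \sum_i x i * y i; set X := \sum_i _ ^+ 2; set b := \sum_i y i ^+ 2.
have b0 : 0 <= b by apply: sumr_ge0 => i _; exact: sqr_ge0.
have : 0 <= \sum_i (b * x i - a * y i) ^+ 2.
  by apply: sumr_ge0 => i _; exact: sqr_ge0.
have expand (c d : R) : \sum_i (c * x i - d * y i) ^+ 2 =
    c ^+ 2 * X - 2 * (d * c) * a + d ^+ 2 * b.
  rewrite !mulr_sumr -sumrB -big_split /=.
  by apply: eq_bigr => i _; ring.
have -> : \sum_i (b * x i - a * y i) ^+ 2 = b * (X * b - a ^+ 2).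
  by rewrite expand; ring.
move: b0; rewrite le_eqVlt => /predU1P[b0 _|b0]; last first.
  by rewrite pmulr_rge0// subr_ge0.
have y0 i : y i = 0.
  apply/eqP; rewrite -sqrf_eq0; apply/eqP; move/esym: b0; rewrite /b => /eqP.
  rewrite psumr_eq0 => [/allP/(_ i)|j _]; last exact: sqr_ge0.
  by rewrite mem_index_enum => /(_ isT)/eqP.
rewrite /a big1 => [|i _]; last by rewrite y0 mulr0.
by rewrite expr0n -b0 mulr0.
Qed.

(** Minkowski's inequality, by squaring and Cauchy-Schwarz. The index type is arbitrary so that
    pairs of matrix indices are covered. *)
Lemma sqrt_sum_sqrD (I : finType) (x y : I -> R) :
  Num.sqrt (\sum_i (x i + y i) ^+ 2) <=
  Num.sqrt (\sum_i x i ^+ 2) + Num.sqrt (\sum_i y i ^+ 2).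
Proof.
have S0 (z : I -> R) : 0 <= \sum_i z i ^+ 2.
  by apply: sumr_ge0 => i _; exact: sqr_ge0.
rewrite -ler_sqr ?nnegrE ?addr_ge0 ?sqrtr_ge0// sqr_sqrtr// sqrrD !sqr_sqrtr//.
have -> : \sum_i (x i + y i) ^+ 2 =
    \sum_i x i ^+ 2 + (\sum_i x i * y i) *+ 2 + \sum_i y i ^+ 2.
  by rewrite -mulr_natr mulr_suml -!big_split/=; apply: eq_bigr => i _; ring.
rewrite lerD2r lerD2l lerMn2r/= -sqrtrM// (le_trans (ler_norm _))//.
by rewrite -sqrtr_sqr ler_wsqrtr// sum_CauchySchwarz.
Qed.

Lemma frob_normE {k l} (M : 'M[R]_(k, l)) :
  frob_norm M = Num.sqrt (\sum_(ij : 'I_k * 'I_l) M ij.1 ij.2 ^+ 2).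
Proof. by rewrite /frob_norm pair_big. Qed.

Lemma frob_norm_ge0 {k l} (M : 'M[R]_(k, l)) : 0 <= frob_norm M.
Proof. exact: sqrtr_ge0. Qed.

Lemma frob_normD {k l} (M N : 'M[R]_(k, l)) :
  frob_norm (M + N) <= frob_norm M + frob_norm N.
Proof.
rewrite !frob_normE; under eq_bigr do rewrite mxE.
exact: (sqrt_sum_sqrD (fun ij => M ij.1 ij.2) (fun ij => N ij.1 ij.2)).
Qed.

Lemma frob_normZ {k l} (c : R) (M : 'M[R]_(k, l)) :
  frob_norm (c *: M) = `|c| * frob_norm M.
Proof.
rewrite !frob_normE; under eq_bigr do rewrite mxE exprMn.
by rewrite -mulr_sumr sqrtrM ?sqr_ge0// sqrtr_sqr.
Qed.

Lemma frob_norm_tr {k l} (M : 'M[R]_(k, l)) : frob_norm M^T = frob_norm M.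
Proof.
rewrite /frob_norm exchange_big /=; congr Num.sqrt.
by apply: eq_bigr => i _; apply: eq_bigr => j _; rewrite mxE.
Qed.

Lemma sqr_frob_norm {k l} (M : 'M[R]_(k, l)) :
  frob_norm M ^+ 2 = \sum_i \sum_j M i j ^+ 2.
Proof.
by rewrite sqr_sqrtr//; do 2![apply: sumr_ge0 => ? _]; exact: sqr_ge0.
Qed.

Lemma frob_norm0 {k l} : frob_norm (0 : 'M[R]_(k, l)) = 0.
Proof.
by rewrite frob_normE big1 ?sqrtr0// => ij _; rewrite mxE expr0n.
Qed.

Lemma frob_norm_eq0 {k l} (M : 'M[R]_(k, l)) : frob_norm M = 0 -> M = 0.
Proof.
move=> M0; apply/matrixP => i j; rewrite mxE; apply/eqP; rewrite -sqrf_eq0.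
have /eqP := sqr_frob_norm M; rewrite M0 expr0n eq_sym pair_big/=.
rewrite psumr_eq0 => [/allP/(_ (i, j))|ij _]; last exact: sqr_ge0.
by rewrite mem_index_enum => /(_ isT).
Qed.

Lemma dotE {k} (u v : 'cV[R]_k) : dot u v = \sum_i u i 0 * v i 0.
Proof. by rewrite /dot mxE; apply: eq_bigr => i _; rewrite mxE. Qed.

Lemma dotC {k} (u v : 'cV[R]_k) : dot u v = dot v u.
Proof. by rewrite !dotE; apply: eq_bigr => i _; rewrite mulrC. Qed.

Lemma dotDl {k} (u v w : 'cV[R]_k) : dot (u + v) w = dot u w + dot v w.
Proof. by rewrite /dot linearD/= mulmxDl mxE. Qed.

Lemma dotDr {k} (u v w : 'cV[R]_k) : dot w (u + v) = dot w u + dot w v.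
Proof. by rewrite dotC dotDl !(dotC w). Qed.

Lemma dot_col_mx {k l} (u u' : 'cV[R]_k) (v v' : 'cV[R]_l) :
  dot (col_mx u v) (col_mx u' v') = dot u u' + dot v v'.
Proof. by rewrite /dot tr_col_mx mul_row_col mxE. Qed.

Lemma dotZl {k} c (u v : 'cV[R]_k) : dot (c *: u) v = c * dot u v.
Proof. by rewrite /dot linearZ/= -scalemxAl mxE. Qed.

Lemma dotZr {k} c (u v : 'cV[R]_k) : dot u (c *: v) = c * dot u v.
Proof. by rewrite dotC dotZl dotC. Qed.

Lemma dot_mull {k l} (M : 'M[R]_(k, l)) u v : dot (M *m u) v = dot u (M^T *m v).
Proof. by rewrite /dot trmx_mul mulmxA. Qed.

Lemma dot_frob {k} (u : 'cV[R]_k) : dot u u = frob_norm u ^+ 2.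
Proof.
by rewrite dotE sqr_frob_norm; apply: eq_bigr => i _; rewrite big_ord1 expr2.
Qed.

Lemma qformE {k} (M : 'M[R]_k) u : qform M u = dot u (M *m u).
Proof. by rewrite /qform /dot mulmxA. Qed.

Lemma qformZ {k} c (M : 'M[R]_k) u : qform (c *: M) u = c * qform M u.
Proof. by rewrite /qform -scalemxAr -scalemxAl mxE. Qed.

Lemma qform_sum {k} (I : finType) (M : I -> 'M[R]_k) u :
  qform (\sum_i M i) u = \sum_i qform (M i) u.
Proof. by rewrite /qform mulmx_sumr mulmx_suml summxE. Qed.

Lemma symmetricP {k} (M : 'M[R]_k) : reflect (M^T = M) (M \is symmetricmx).
Proof.
by apply: (iffP (is_hermitianmxP _ _ _)); rewrite expr0 scale1r map_mx_id.
Qed.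

End EuclideanNorm.

(** * Square roots of positive semidefinite matrices *)

Section SquareRoot.
Context {R : realType}.

Lemma poly_interpolation (F : fieldType) (f : F -> F) (s : seq F) :
  exists p : {poly F}, {in s, forall x, p.[x] = f x}.
Proof.
elim: s => [|x s [p ps]]; first by exists 0.
have [xs|xs] := boolP (x \in s).
  by exists p => y; rewrite inE => /predU1P[->|]; exact: ps.
pose q := \prod_(y <- s) ('X - y%:P).
have qx : q.[x] != 0 by rewrite -rootE root_prod_XsubC.
(* Newton's correction: [q] vanishes on [s] but not at [x], so the values already matched are
   kept. *)
exists (p + ((f x - p.[x]) / q.[x]) *: q) => y.
rewrite inE hornerD hornerZ => /predU1P[->|ys]; first by rewrite divfK// subrKC.
have /rootP -> : root q y by rewrite root_prod_XsubC.
by rewrite mulr0 addr0 ps.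
Qed.

Lemma tr_horner_mx (F : comNzRingType) k (M : 'M[F]_k.+1) (p : {poly F}) :
  (horner_mx M p)^T = horner_mx M^T p.
Proof.
elim/poly_ind: p => [|p c IH]; first by rewrite !rmorph0 trmx0.
rewrite !rmorphD !rmorphM/= !horner_mx_X !horner_mx_C linearD/= tr_scalar_mx.
rewrite -!mulmxE trmx_mul IH; congr (_ + _).
by apply: comm_mx_horner; rewrite /comm_mx.
Qed.

(** At a row eigenvector [v], the form [qform M v^T] is [a] times the squared norm of [v]. *)
Lemma psdmx_eigenvalue_ge0 k (M : 'M[R]_k) a : psdmx M -> eigenvalue M a -> 0 <= a.
Proof.
move=> [/symmetricP symM posM] /eigenvalueP[v vM v0].
have := posM v^T; rewrite /qform trmxK vM -scalemxAl mxE.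
have -> : (v *m v^T) 0 0 = frob_norm v^T ^+ 2 by rewrite -dot_frob /dot trmxK.
rewrite pmulr_lge0// lt_neqAle sqr_ge0 eq_sym sqrf_eq0 andbT.
by apply: contra v0 => /eqP/frob_norm_eq0/eqP; rewrite trmx_eq0.
Qed.

(** The complexification of [M] is hermitian, so the spectral theorem diagonalizes it with real
    eigenvalues; these are eigenvalues of [M] itself, hence nonnegative. *)
Lemma psdmx_diagonalizable k (M : 'M[R]_k.+1) : psdmx M ->
  exists P (D : 'rV[R]_k.+1),
    [/\ P \in unitmx, forall i, 0 <= D 0 i &
    map_mx (real_complex R) M =
      invmx P *m diag_mx (map_mx (real_complex R) D) *m P].
Proof.
move=> psdM; have /symmetricP symM := psdM.1.
pose toC := real_complex R; pose MC := map_mx toC M.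
have realC (x : R) : toC x \is Num.real.
  by rewrite complex_real.
have rMC : MC \is a mxOver Num.real by apply/mxOverP => i j; rewrite mxE.
have sMC : MC \is symmetricmx.
  apply/is_hermitianmxP; rewrite expr0 scale1r map_mx_id//.
  by apply/matrixP => i j; rewrite !mxE -[in LHS]symM mxE.
have hMC := realsym_hermsym sMC rMC.
have Drl := hermitian_spectral_diag_real hMC.
have MCE := orthomx_spectralP (hermitian_normalmx hMC).
set P := spectralmx MC in MCE *; set D := spectral_diag MC in MCE Drl *.
have uP : P \in unitmx by exact: spectral_unit.
pose DR := map_mx (@complex.Re R) D.
have DE : map_mx toC DR = D.
  by apply/rowP => i; rewrite !mxE; apply/RRe_real; exact: (mxOverP Drl).
exists P, DR; rewrite -/toC DE; split => // i.
apply: (psdmx_eigenvalue_ge0 psdM).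
(* Characteristic polynomials commute with the embedding of the reals, so a complex eigenvector
   suffices: row [i] of [P], nonzero because [P] is invertible. *)
rewrite eigenvalue_root_char -(fmorph_root toC) map_char_poly -eigenvalue_root_char.
apply/eigenvalueP; exists (row i P); last first.
  apply/eqP => rP0; have := mulmxV uP => /(congr1 (row i)).
  rewrite row_mul rP0 mul0mx => /rowP/(_ i)/eqP.
  by rewrite !mxE eqxx eq_sym oner_eq0.
rewrite -/MC MCE -row_mul !mulmxA mulmxV// mul1mx row_mul row_diag_mx.
by rewrite -scalemxAl -rowE -[in LHS]DE mxE.
Qed.

(* Interpolate the fourth root on the spectrum: [T = p M] is symmetric with
   [T^4 = M], so [T^2] is a square root of [M] that is visibly psd. *)
Lemma exists_sqrtmx k (M : 'M[R]_k) : psdmx M -> exists S, psdmx S /\ S *m S = M.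
Proof.
case: k M => [|k] M psdM; first by exists M; rewrite [_ *m _]flatmx0 [M in _ = M]flatmx0.
have [P [D [uP D0 ME]]] := psdmx_diagonalizable psdM.
have [p pE] := poly_interpolation (fun x => Num.sqrt (Num.sqrt x))
  [seq D 0 i | i : 'I_k.+1].
pose T := horner_mx M p.
have symT : T^T = T by rewrite tr_horner_mx (symmetricP _ psdM.1).
have T4 : T *m T *m (T *m T) = M.
  (* The identity is checked over the complex numbers, where [p] acts on each diagonal entry as the
     fourth root. *)
  apply: (map_mx_inj (f := real_complex R)); rewrite /T !mulmxE -!rmorphM.
  rewrite map_horner_mx/= ME horner_mx_uconjC// horner_mx_diag.
  congr (_ *m diag_mx _ *m _).
  apply/rowP => i; rewrite !mxE horner_map !hornerM pE; last first.
    by apply/mapP; exists i => //; rewrite mem_enum.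
  by rewrite -!expr2 !sqr_sqrtr ?sqrtr_ge0.
exists (T *m T); split => //; split => [|u].
  by apply/symmetricP; rewrite trmx_mul symT.
rewrite qformE -mulmxA -{1}symT -dot_mull dot_frob; exact: sqr_ge0.
Qed.

Lemma sqrtmxP k (M : 'M[R]_k) : psdmx M -> psdmx (sqrtmx M) /\ sqrtmx M *m sqrtmx M = M.
Proof.
move=> /exists_sqrtmx[S SM].
exact: (@xgetPex _ 0 [set S | psdmx S /\ S *m S = M] (ex_intro _ S SM)).
Qed.

Lemma tr_sqrtmx k (M : 'M[R]_k) : psdmx M -> (sqrtmx M)^T = sqrtmx M.
Proof. by move=> /sqrtmxP[[/symmetricP]]. Qed.

(** Turns each term of [maxnorm] into a Euclidean norm, to which the triangle inequality and the
    tail bound apply. *)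
Lemma sqrt_qform k (M : 'M[R]_k) u : psdmx M ->
  Num.sqrt (qform M u) = frob_norm (sqrtmx M *m u).
Proof.
move=> psdM; rewrite -{1}(sqrtmxP psdM).2 qformE -mulmxA.
by rewrite -{1}(tr_sqrtmx psdM) -dot_mull dot_frob sqrtr_sqr ger0_norm ?frob_norm_ge0.
Qed.

End SquareRoot.

(** * Sub-Gaussian tails *)

Section SubGaussian.
Context {R : realType} {d : measure_display} {Omega : measurableType d}
  (P : probability Omega R).
Local Notation MR := (measurableTypeR R).
Local Notation leb := (@lebesgue_measure R).

(** Completing the square: [a x - x^2 / 2 = a^2 / 2 - (x - a)^2 / 2]. *)
Lemma normal_pdf_tilt (a x : R) :
  expR (a * x) * normal_pdf 0 1 x = expR (a ^+ 2 / 2) * normal_pdf a 1 x.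
Proof.
rewrite !normal_pdfE ?oner_eq0// /normal_fun mulrCA [RHS]mulrCA -!expRD.
by congr (_ * expR _); rewrite expr1n; field.
Qed.

(** The exponents add up to [- (1 - s) x^2 / 2], that of a centred Gaussian of variance
    [1 / (1 - s)]; the prefactor corrects the normalization. *)
Lemma normal_pdf_scale (s x : R) : s < 1 ->
  expR (s * x ^+ 2 / 2) * normal_pdf 0 1 x =
  (Num.sqrt (1 - s))^-1 * normal_pdf 0 (Num.sqrt (1 - s))^-1 x.
Proof.
move=> s1; have r0 : 0 < Num.sqrt (1 - s) by rewrite sqrtr_gt0 subr_gt0.
have rE : Num.sqrt (1 - s) ^+ 2 = 1 - s by rewrite sqr_sqrtr// subr_ge0 ltW.
rewrite !normal_pdfE ?invr_eq0 ?gt_eqF// /normal_peak /normal_fun !subr0.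
rewrite exprVn rE expr1n mul1r mulrCA -expRD mulrA; congr (_ * expR _).
  rewrite -mulrnAr [in RHS]sqrtrM ?invr_ge0 ?subr_ge0 1?ltW// sqrtrV ?subr_ge0 1?ltW//.
  by rewrite invfM invrK mulKf// gt_eqF.
by field; rewrite subr_eq0 gt_eqF.
Qed.

(* Averaging [exp (sqrt s * g * Y)] over a standard Gaussian [g] gives
   [exp (s * Y^2 / 2)]; Tonelli swaps this average with the expectation. *)
Lemma subgaussian_sqr_mgf (Y : Omega -> R) (s : R) :
  measurable_fun setT Y ->
  (forall t, \int[P]_w (expR (t * Y w))%:E <= (expR (t ^+ 2 / 2))%:E)%E ->
  0 <= s -> s < 1 ->
  (\int[P]_w (expR (s * Y w ^+ 2 / 2))%:E <= (Num.sqrt (1 - s))^-1%:E)%E.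
Proof.
move=> mY mgfY s0 s1.
pose f (wg : Omega * MR) : \bar R :=
  (expR (Num.sqrt s * wg.2 * Y wg.1) * normal_pdf 0 1 wg.2)%:E.
have f0 wg : (0 <= f wg)%E.
  by rewrite lee_fin mulr_ge0 ?expR_ge0 ?normal_pdf_ge0.
have mf : measurable_fun setT f.
  apply/measurable_EFinP; apply: measurable_funM.
    apply: measurableT_comp => //; apply: measurable_funM.
      by apply: measurable_funM => //; exact: measurable_snd.
    by apply: (measurableT_comp mY); exact: measurable_fst.
  by apply: (measurableT_comp (measurable_normal_pdf _ _)); exact: measurable_snd.
have mpdf m r : measurable_fun [set: MR] (fun x => (normal_pdf m r x)%:E : \bar R).
  by apply/measurable_EFinP; exact: measurable_normal_pdf.
have pdf0 m r x : (0 <= (normal_pdf m r x)%:E :> \bar R)%E.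
  by rewrite lee_fin normal_pdf_ge0.
have -> : (\int[P]_w (expR (s * Y w ^+ 2 / 2))%:E =
    \int[P]_w \int[leb]_g f (w, g))%E.
  apply: eq_integral => w _.
  transitivity (\int[leb]_g
      ((expR (s * Y w ^+ 2 / 2))%:E * (normal_pdf (Num.sqrt s * Y w) 1 g)%:E))%E.
    rewrite (@ge0_integralZl _ _ _ leb)//; first by rewrite integral_normal_pdf mule1.
  apply: eq_integral => g _; rewrite /f /= (mulrAC _ g) normal_pdf_tilt.
  by rewrite exprMn sqr_sqrtr// EFinM.
rewrite fubini_tonelli//.
(* For fixed [g], the hypothesis at [t = sqrt s * g] bounds the inner expectation by
   [exp (s g^2 / 2)]; multiplied by the standard density this is a multiple of another Gaussian
   density, of mass 1. *)
apply: (@le_trans _ _ (\int[leb]_g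
    ((Num.sqrt (1 - s))^-1%:E * (normal_pdf 0 (Num.sqrt (1 - s))^-1 g)%:E))%E).
  apply: ge0_le_integral => //.
  - by move=> g _; apply: integral_ge0.
  - exact: measurable_fun_fubini_tonelli_G.
  - by apply: measurable_funeM; exact: mpdf.
  move=> g _; rewrite -EFinM -normal_pdf_scale//.
  under eq_integral do rewrite /f /= EFinM muleC.
  rewrite (@ge0_integralZl _ _ _ P)//.
  - rewrite EFinM muleC; apply: lee_wpmul2r; first exact: pdf0.
    by apply: le_trans (mgfY _) _; rewrite exprMn sqr_sqrtr.
  - apply/measurable_EFinP; apply: measurableT_comp => //.
    exact: measurable_funM.
by rewrite (@ge0_integralZl _ _ _ leb)// integral_normal_pdf mule1.
Qed.

(** Averages the tangent line inequality [exp m * (1 + (a i - m)) <= exp (a i)] at the mean [m]. *)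
Lemma expR_Jensen N (p a : 'I_N -> R) :
  (forall i, 0 <= p i) -> \sum_i p i = 1 ->
  expR (\sum_i p i * a i) <= \sum_i p i * expR (a i).
Proof.
move=> p0 p1; set m := \sum_i p i * a i.
have -> : expR m = \sum_i p i * (expR m * (1 + (a i - m))).
  transitivity (expR m * (\sum_i p i + (m - m * \sum_i p i))).
    by rewrite p1; ring.
  rewrite /m !mulr_sumr -sumrB -big_split/= mulr_sumr.
  by apply: eq_bigr => i _; ring.
apply: ler_sum => i _; apply: ler_wpM2l => //.
rewrite -{2}(subrKC m (a i)) expRD ler_wpM2l ?expR_ge0//.
exact: expR_ge1Dx.
Qed.

Lemma measurable_fun_sqrt (f : Omega -> R) :
  measurable_fun setT f -> measurable_fun setT (fun w => Num.sqrt (f w)).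
Proof.
move=> mf; apply: (measurableT_comp (f := @Num.sqrt R)) => //.
apply: continuous_measurable_fun; exact: sqrt_continuous.
Qed.

Lemma measurable_gt_cst (f : Omega -> R) c :
  measurable_fun setT f -> measurable [set w | c < f w].
Proof.
move=> /(_ measurableT `]c, +oo[%classic (measurable_itv _)); rewrite setTI.
by congr measurable; apply/seteqP; split => w /=; rewrite in_itv/= andbT.
Qed.

(** After Jensen's inequality only the expectation of each [exp (s (Y i)^2 / 2)] enters, so the
    [Y i] may depend on each other arbitrarily. *)
Lemma subgaussian_mix_tail N (p : 'I_N -> R) (Y : 'I_N -> Omega -> R) (r : R) :
  (forall i, 0 <= p i) -> \sum_i p i = 1 ->
  (forall i, measurable_fun setT (Y i)) ->
  (forall i t,
     \int[P]_w (expR (t * Y i w))%:E <= (expR (t ^+ 2 / 2))%:E)%E ->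
  0 <= r ->
  (P [set w | (1 + r < Num.sqrt (\sum_i p i * Y i w ^+ 2))%R] <=
   (expR (- (r ^+ 2 / 2)))%:E)%E.
Proof.
move=> p0 p1 mY mgfY r0.
(* This [s] makes the moment bound [(1 - s)^(-1/2)] equal to the threshold [c]. *)
set A := [set w | _]; pose c := 1 + r; pose s := 1 - c ^- 2.
have c1 : 1 <= c by rewrite lerDl.
have c0 : 0 < c by rewrite (lt_le_trans ltr01).
have c2 : 0 < c ^- 2 by rewrite invr_gt0 exprn_gt0.
have s0 : 0 <= s by rewrite subr_ge0 invf_le1 ?exprn_gt0// expr_ge1// ltW.
have s1 : s < 1 by rewrite gtrBl.
have sqrt1s : (Num.sqrt (1 - s))^-1 = c.
  by rewrite /s subKr -exprVn sqrtr_sqr ger0_norm ?invr_ge0 ?ltW// invrK.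
have mS : measurable_fun setT (fun w => \sum_i p i * Y i w ^+ 2).
  apply: measurable_sum => i; apply: measurable_funM => //.
  exact: measurable_funX.
have mA : measurable A.
  exact/measurable_gt_cst/measurable_fun_sqrt.
pose b := expR (- (s * c ^+ 2 / 2)).
(* Since [s c^2 = c^2 - 1 = 2 r + r^2], the factor [b] is [exp (- r - r^2 / 2)], and
   [c = 1 + r <= exp r] absorbs the moment bound. *)
have bE : b * c <= expR (- (r ^+ 2 / 2)).
  have -> : expR (- (r ^+ 2 / 2)) = b * expR r.
    by rewrite -expRD; congr expR; rewrite /s /c; field; rewrite gt_eqF.
  by rewrite ler_wpM2l ?expR_ge0// expR_ge1Dx.
have mE i : measurable_fun setT (fun w => (expR (s * Y i w ^+ 2 / 2))%:E : \bar R).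
  apply/measurable_EFinP; apply: measurableT_comp => //.
  apply: measurable_funM => //; apply: measurable_funM => //.
  exact: measurable_funX.
have pb0 i : 0 <= p i * b by rewrite mulr_ge0 ?expR_ge0.
rewrite -[A]setIT -integral_indic//.
apply: (@le_trans _ _ (\int[P]_w
  (\sum_(i < N) (p i * b)%:E * (expR (s * Y i w ^+ 2 / 2))%:E))%E).
  apply: ge0_le_integral => //.
  - exact/measurable_EFinP/measurable_indic.
  - by apply: emeasurable_sum => i; apply: measurable_funeM.
  move=> w _; under eq_bigr do rewrite -EFinM.
  rewrite sumEFin lee_fin; under eq_bigr do rewrite mulrAC.
  rewrite -mulr_suml mulrC.
  apply: (@le_trans _ _ (b * expR (\sum_i p i * (s * Y i w ^+ 2 / 2)))).
    (* Pointwise Markov inequality: on [A] the weighted sum exceeds [c^2], so the exponent is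
       nonnegative; off [A] the indicator is 0. *)
    rewrite -expRD indicE; case: (asboolP (A w)) => wA; last first.
      by rewrite memNset// expR_ge0.
    rewrite mem_set// -[leLHS]expR0 ler_expR addrC subr_ge0.
    have -> : \sum_i p i * (s * Y i w ^+ 2 / 2) = s * (\sum_i p i * Y i w ^+ 2) / 2.
      by rewrite mulr_sumr mulr_suml; apply: eq_bigr => i _; ring.
    rewrite ler_pM2r// ler_wpM2l//.
    have S0 : 0 <= \sum_i p i * Y i w ^+ 2.
      by apply: sumr_ge0 => i _; rewrite mulr_ge0// sqr_ge0.
    rewrite -[leRHS]sqr_sqrtr//; apply: lerXn2r; rewrite ?nnegrE ?sqrtr_ge0// ltW//.
  by rewrite ler_wpM2l ?expR_ge0// expR_Jensen.
rewrite ge0_integral_sum//; last 2 first.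
- by move=> i; apply: measurable_funeM.
- by move=> i w _; rewrite -EFinM lee_fin mulr_ge0 ?expR_ge0.
apply: (@le_trans _ _ (\sum_(i < N) (p i * b)%:E * c%:E)%E).
  apply: lee_sum => i _; rewrite ge0_integralZl//; last by rewrite lee_fin.
  apply: lee_wpmul2l; first by rewrite lee_fin.
  by rewrite -sqrt1s; exact: subgaussian_sqr_mgf.
under eq_bigr do rewrite -EFinM; rewrite sumEFin lee_fin.
by under eq_bigr do rewrite -mulrA; rewrite -mulr_suml p1 mul1r.
Qed.

Lemma measurable_rvec_mul k l (M : 'M[R]_(l, k)) (X : 'I_k -> {RV P >-> R}) i :
  measurable_fun setT (fun w => (M *m rvec X w) i 0).
Proof.
under eq_fun do rewrite mxE; apply: measurable_sum => j.
apply: measurable_funM => //; under eq_fun do rewrite mxE.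
exact: measurable_funPT.
Qed.

Lemma measurable_frob_norm k (V : Omega -> 'cV[R]_k) :
  (forall i, measurable_fun setT (fun w => V w i 0)) ->
  measurable_fun setT (fun w => frob_norm (V w)).
Proof.
move=> mV; apply: measurable_fun_sqrt; apply: measurable_sum => i.
by under eq_fun do rewrite big_ord1; exact: measurable_funX.
Qed.

Lemma subgaussian_frob_tail k l (sg : R) (X : 'I_k -> {RV P >-> R})
    (M : 'M[R]_(l, k)) (delta : R) :
  0 < sg -> zero_mean_subgaussian sg X -> 0 < delta -> delta <= 1 ->
  (P [set w | ((1 + Num.sqrt (2 * ln delta^-1)) * (sg * frob_norm M) <
               frob_norm (M *m rvec X w))%R] <= delta%:E)%E.
Proof.
move=> sg0 [_ subX] d0 d1; set r := Num.sqrt _.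
(* The weights below divide by the squared norm of [M]; for [M = 0] the event is empty because its
   inequality is strict. *)
have [F0|F0] := eqVneq (frob_norm M) 0.
  rewrite (_ : [set w | _] = set0); first by rewrite measure0 lee_fin ltW.
  apply/seteqP; split => w //=.
  by rewrite F0 (frob_norm_eq0 F0) mul0mx frob_norm0 !mulr0 ltxx.
have Fgt0 : 0 < frob_norm M by rewrite lt_neqAle eq_sym F0 frob_norm_ge0.
pose F2 := frob_norm M ^+ 2; have F2gt0 : 0 < F2 by rewrite exprn_gt0.
pose p i := (\sum_j M i j ^+ 2) / F2.
have S0 i : 0 <= \sum_j M i j ^+ 2 by apply: sumr_ge0 => j _; exact: sqr_ge0.
have p0 i : 0 <= p i by rewrite divr_ge0 ?(ltW F2gt0).
have p1 : \sum_i p i = 1.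
  by rewrite -mulr_suml -sqr_frob_norm divff// gt_eqF.
(* The norm of row [i] is [sqrt (p i) * frob_norm M], so [Y i] is sub-Gaussian with parameter 1. For
   a zero row the convention [0^-1 = 0] makes [Y i] vanish. *)
pose c i := (Num.sqrt (p i))^-1 / (sg * frob_norm M).
pose Y i w := c i * (M *m rvec X w) i 0.
have rE : r ^+ 2 / 2 = ln delta^-1.
  rewrite sqr_sqrtr; first by rewrite mulrAC divff ?mul1r// pnatr_eq0.
  by rewrite mulr_ge0// ln_ge0// invf_ge1.
have -> : delta = expR (- (r ^+ 2 / 2)).
  by rewrite rE lnV ?opprK ?lnK// posrE.
rewrite (_ : [set w | _] =
    [set w | 1 + r < Num.sqrt (\sum_i p i * Y i w ^+ 2)]); last first.
  apply/funext => w /=.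
  have -> : frob_norm (M *m rvec X w) =
      Num.sqrt (\sum_i p i * Y i w ^+ 2) * (sg * frob_norm M).
    rewrite -[in RHS](ger0_norm (ltW (mulr_gt0 sg0 Fgt0))) -sqrtr_sqr -sqrtrM; last first.
      by apply: sumr_ge0 => i _; rewrite mulr_ge0// sqr_ge0.
    congr Num.sqrt; rewrite mulr_suml; apply: eq_bigr => i _; rewrite big_ord1 /Y.
    have [pi0|pi0] := eqVneq (p i) 0; last first.
      rewrite /c !exprMn !exprVn sqr_sqrtr// exprMn.
      by field; rewrite pi0 F0 gt_eqF.
    rewrite pi0 !mul0r mxE big1 ?expr0n// => j _.
    have /eqP : \sum_j M i j ^+ 2 = 0.
      by apply/eqP; move/eqP: pi0; rewrite mulf_eq0 invr_eq0 (gt_eqF F2gt0) orbF.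
    rewrite psumr_eq0 => [/allP/(_ j)|? _]; last exact: sqr_ge0.
    by rewrite mem_index_enum sqrf_eq0 => /(_ isT)/eqP->; rewrite mul0r.
  by rewrite ltr_pM2r ?mulr_gt0.
apply: subgaussian_mix_tail => //.
- move=> i; apply: measurable_funM => //; exact: measurable_rvec_mul.
- move=> i t; have := subX ((t * c i) *: (row i M)^T).
  have -> : ('E_P[fun w => expR (dot ((t * c i) *: (row i M)^T) (rvec X w))] =
      \int[P]_w (expR (t * Y i w))%:E)%E.
    rewrite unlock; apply: eq_integral => w _; congr (expR _)%:E.
    by rewrite dotZl -mulrA /dot trmxK -row_mul mxE.
  move=> /le_trans; apply; rewrite lee_fin ler_expR.
  rewrite dotZl dotZr dot_frob frob_norm_tr sqr_frob_norm big_ord1.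
  under eq_bigr do rewrite mxE.
  have -> : \sum_j M i j ^+ 2 = p i * F2 by rewrite divfK// gt_eqF.
  have [pi0|pi0] := eqVneq (p i) 0.
    by rewrite pi0 mul0r !mulr0 divr_ge0// sqr_ge0.
  rewrite le_eqVlt; apply/orP; left; apply/eqP.
  have sp0 : Num.sqrt (p i) != 0.
    by rewrite gt_eqF// sqrtr_gt0 lt_neqAle eq_sym pi0 p0.
  rewrite -[X in X * F2](sqr_sqrtr (p0 i)) /c /F2.
  by field; rewrite sp0 F0 gt_eqF.
- exact: sqrtr_ge0.
Qed.

End SubGaussian.

(** * Linear matrix inequalities *)

Section AffineMinimum.
Context {R : realType}.

Lemma continuous_rV_mulmx N (c : 'cV[R]_N) :
  continuous (fun z : 'rV[R]_N => (z *m c) 0 0).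
Proof.
have -> : (fun z : 'rV[R]_N => (z *m c) 0 0) = (fun z => \sum_i z 0 i * c i 0).
  by apply/funext => z; rewrite mxE.
apply: continuous_big => [|i _ z]; first exact: add_continuous.
apply: (@cvgM R 'rV[R]_N (nbhs z) _ (fun z => z 0 i) (cst (c i 0))).
  exact: coord_continuous.
exact: cvg_cst.
Qed.

Lemma closed_affine_ge0 N (I : Type) (D : set I) (a : I -> R) (c : I -> 'cV[R]_N) :
  closed [set z : 'rV[R]_N | forall i, D i -> 0 <= a i + (z *m c i) 0 0].
Proof.
have -> : [set z : 'rV[R]_N | forall i, D i -> 0 <= a i + (z *m c i) 0 0] =
    \bigcap_(i in D) (fun z : 'rV[R]_N => (z *m c i) 0 0) @^-1` [set x | - a i <= x].
  by apply/seteqP; split => z h i Di; have := h i Di; rewrite /= -lerBlDl sub0r.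
apply: closed_bigI => i _; apply: closed_comp; last exact: closed_ge.
by move=> z _; exact: continuous_rV_mulmx.
Qed.

(** The sublevel set of [z0] is closed and lies in a box, hence is compact; outside it the
    functional is larger than at [z0]. *)
Lemma affine_min_attained N (I : Type) (D : set I) (a : I -> R)
    (c : I -> 'cV[R]_N) (b : R) (e : 'cV[R]_N) (z0 : 'rV[R]_N) :
  let Z := [set z : 'rV[R]_N | forall i, D i -> 0 <= a i + (z *m c i) 0 0] in
  Z z0 ->
  (forall z, Z z -> (z *m e) 0 0 <= (z0 *m e) 0 0 -> forall j, 0 <= z 0 j <= b) ->
  exists2 z, Z z & forall z', Z z' -> (z *m e) 0 0 <= (z' *m e) 0 0.
Proof.
move=> Z Zz0 bnd.
pose f (z : 'rV[R]_N) := (z *m e) 0 0.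
pose Z0 := Z `&` [set z | f z <= f z0].
have cZ0 : compact Z0.
  apply: (@subclosed_compact _ _
    [set z : 'rV[R]_N | forall j, `[0, b]%classic (z ord0 j)]).
  - apply: closedI; first exact: closed_affine_ge0.
    apply: (@closed_comp _ _ f [set x | x <= f z0]); last exact: closed_le.
    by move=> z _; exact: continuous_rV_mulmx.
  - by apply: (@rV_compact _ _ (fun=> `[0, b]%classic)) => _; exact: segment_compact.
  - by move=> z [Zz zz0] j; rewrite /= in_itv/=; exact: bnd.
have [||z] := @compact_EVT_min _ _ f Z0 _ cZ0.
- by exists z0; split => /=.
- by apply: continuous_subspaceT; exact: continuous_rV_mulmx.
rewrite inE => -[Zz zz0] zmin; exists z => // z' Zz'.
have [le0|gt0] := leP (f z') (f z0); first by apply: zmin; rewrite inE.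
exact: le_trans zz0 (ltW gt0).
Qed.

End AffineMinimum.

(** * The block form shared by both matrix inequalities *)

Section HalfBlock.
Context {R : realType} {r n : nat}.
Implicit Types (G : 'M[R]_(r, n)) (Q : 'M[R]_n) (u : 'cV[R]_r) (x : 'cV[R]_n).

(** The two halves of [G] add up to a single cross term [dot u (G *m x)] in the quadratic form. *)
Definition half_block (lambda : R) G Q : 'M[R]_(r + n) :=
  block_mx lambda%:M (2^-1 *: G) (2^-1 *: G^T) Q.

Lemma qform_half_block lambda G Q u x :
  qform (half_block lambda G Q) (col_mx u x) =
  lambda * dot u u + dot u (G *m x) + qform Q x.
Proof.
rewrite qformE /half_block mul_block_col dot_col_mx mul_scalar_mx -!scalemxAl.
rewrite !dotDr !dotZr [dot x (G^T *m u)]dotC dot_mull trmxK -qformE.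
by field.
Qed.

Lemma psdmx_half_block lambda G Q : Q \is symmetricmx ->
  psdmx (half_block lambda G Q) <->
  forall u x, 0 <= lambda * dot u u + dot u (G *m x) + qform Q x.
Proof.
move=> /symmetricP symQ; split=> [[_ psd] u x|psd].
  by rewrite -qform_half_block.
split=> [|v]; last by rewrite -[v]vsubmxK qform_half_block.
apply/symmetricP; rewrite /half_block tr_block_mx tr_scalar_mx symQ.
by rewrite !linearZ/= trmxK.
Qed.

(* Test the matrix on [col_mx u x] with [u] the unit vector opposite to
   [G *m x] (any unit vector if [G *m x = 0]). *)
Lemma half_block_frob_norm lambda G Q x : (0 < r)%N ->
  psdmx (half_block lambda G Q) -> frob_norm (G *m x) <= lambda + qform Q x.
Proof.
move=> r0 [_ psd]; set y := G *m x.
suff [u u1 uy] : exists2 u, dot u u = 1 & dot u y = - frob_norm y.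
  have := psd (col_mx u x); rewrite qform_half_block u1 -/y uy; lra.
have [y0|y0] := eqVneq (frob_norm y) 0; last first.
  exists (- (frob_norm y)^-1 *: y); rewrite ?dotZl ?dotZr dot_frob.
    by field.
  by field.
exists (delta_mx (Ordinal r0) 0).
  by rewrite /dot trmx_delta mul_delta_mx mxE !eqxx.
rewrite y0 (frob_norm_eq0 y0) oppr0 /dot mulmx0 mxE //.
Qed.

End HalfBlock.

(** * Positive definite lower right blocks *)

Section PositiveDefinite.
Context {R : realType}.

Lemma pdmx_unit n (Q : 'M[R]_n) : pdmx Q -> Q \in unitmx.
Proof.
move=> [symQ pdQ]; rewrite -unitmx_tr -row_free_unit -kermx_eq0.
apply/eqP/row_matrixP => i; rewrite row0; apply/eqP.
apply: contraT => ki0; have := pdQ (row i (kermx Q^T))^T.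
rewrite trmx_eq0 => /(_ ki0); rewrite qformE -[Q in Q *m _]trmxK -trmx_mul.
by rewrite -row_mul mulmx_ker row0 trmx0 /dot mulmx0 mxE ltxx.
Qed.

(** Crude entrywise bound from [|u i| |u j| <= ((u i)^2 + (u j)^2) / 2]; it supplies an explicit
    [lambda] below. *)
Lemma qform_le_frob n (N : 'M[R]_n) u :
  qform N u <= (\sum_i \sum_j `|N i j|) * dot u u.
Proof.
rewrite qformE dotE mulr_suml; apply: ler_sum => i _.
rewrite mxE mulr_sumr mulr_suml; apply: ler_sum => j _.
have u2 k : u k 0 ^+ 2 <= dot u u.
  rewrite dotE (bigD1 k)//= -expr2 lerDl.
  by apply: sumr_ge0 => l _; rewrite -expr2 sqr_ge0.
apply: le_trans (ler_norm _) _.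
rewrite mulrCA normrM ler_wpM2l// normrM.
have := u2 i; have := u2 j; rewrite -[u i 0 ^+ 2]real_normK ?num_real//.
rewrite -[u j 0 ^+ 2]real_normK ?num_real//.
have := sqr_ge0 (`|u i 0| - `|u j 0|); set a := `|u i 0|; set b := `|u j 0|.
rewrite sqrrB -mulr_natr; lra.
Qed.

(* Completing the square with [y = Q^-1 G^T u] bounds the form below by
   [lambda * dot u u - qform Q y / 4]. *)
Lemma half_block_feasible r n (G : 'M[R]_(r, n)) (Q : 'M[R]_n) : pdmx Q ->
  exists lambda, psdmx (half_block lambda G Q).
Proof.
move=> pdQ; have uQ := pdmx_unit pdQ; have /symmetricP symQ := pdQ.1.
have psdQ x : 0 <= qform Q x.
  have [->|/pdQ.2/ltW//] := eqVneq x 0.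
  by rewrite qformE /dot !mulmx0 mxE.
pose N := G *m invmx Q *m G^T.
exists (\sum_i \sum_j `|N i j|); apply/psdmx_half_block => [|u x]; first exact: pdQ.1.
(* The factor 1/2 makes the cross term of [qform Q (x + y)] equal to [dot u (G *m x)]. *)
pose y := 2^-1 *: (invmx Q *m G^T *m u).
have Qy : Q *m y = 2^-1 *: (G^T *m u) by rewrite -scalemxAr !mulmxA mulmxV// mul1mx.
have symI : (invmx Q)^T = invmx Q by rewrite trmx_inv symQ.
have yy : qform Q y = 4^-1 * qform N u.
  rewrite qformE Qy dotZl dotZr -mulmxA dot_mull symI dot_mull trmxK qformE.
  by rewrite /N !mulmxA; field.
have xy : qform Q (x + y) = qform Q x + dot u (G *m x) + qform Q y.
  rewrite !qformE mulmxDr dotDl !dotDr.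
  rewrite [dot y (Q *m x)]dotC.
  rewrite [dot (Q *m x) y]dot_mull symQ Qy dotZr [dot x (G^T *m u)]dotC dot_mull trmxK.
  by field.
(* The form to bound is [lambda * dot u u + qform Q (x + y) - qform Q y], and [0 <= 4 * qform Q y =
   qform N u <= lambda * dot u u]. *)
have := psdQ (x + y); rewrite xy yy.
have := qform_le_frob N u; have := psdQ y; rewrite yy; lra.
Qed.

End PositiveDefinite.

Section Encoding.
Context {R : realType} {K : nat}.

(** The unknowns are packed into one row vector, and [coeff] holds the coefficients of a linear form
    in them, so that [affine_min_attained] applies. *)
Definition encode (rho lambda : R) (mu : 'cV[R]_K) : 'rV[R]_(1 + (1 + K)) :=
  row_mx rho%:M (row_mx lambda%:M mu^T).

Definition coeff (p q : R) (v : 'cV[R]_K) : 'cV[R]_(1 + (1 + K)) :=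
  col_mx p%:M (col_mx q%:M v).

Lemma encode_coeff rho lambda mu p q v :
  (encode rho lambda mu *m coeff p q v) 0 0 =
  rho * p + lambda * q + dot mu v.
Proof.
rewrite /encode /coeff !mul_row_col -!scalar_mxM mxE [in RHS]/dot [in LHS]mxE.
by rewrite !mxE eqxx !mulr1n [_ + (_ + _)]addrA.
Qed.

Lemma encode_surj z : exists rho lambda mu, z = encode rho lambda mu.
Proof.
exists (lsubmx z 0 0), (lsubmx (rsubmx z) 0 0), (rsubmx (rsubmx z))^T.
by rewrite /encode trmxK -!mx11_scalar !hsubmxK.
Qed.

Lemma encode_bound rho lambda (mu : 'cV[R]_K) b j :
  0 <= rho <= b -> 0 <= lambda <= b -> (forall k, 0 <= mu k 0 <= b) ->
  0 <= encode rho lambda mu 0 j <= b.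
Proof.
move=> hr hl hm; rewrite mxE; case: splitP => i _.
  by rewrite ord1 mxE eqxx mulr1n.
rewrite mxE; case: splitP => k _; first by rewrite ord1 mxE eqxx mulr1n.
by rewrite mxE.
Qed.

End Encoding.

(** * The least bound certified by one matrix inequality *)

Section LmiProblem.
Context {R : realType} {n K : nat} (Tk : 'I_K -> 'M[R]_n) (T : set 'cV[R]_K).
Context (Tk_psd : forall k, psdmx (Tk k)).
Context (T_nonneg : forall t, T t -> nonneg_vec t) (T_compact : compact T)
  (T_interior : interior T !=set0).

Let T0 : T !=set0.
Proof. by case: T_interior => t /interior_subset; exists t. Qed.

(** Replaces the support function by a family of linear inequalities in [y]. Compactness and
    nonemptiness of [T] make [sup] a genuine least upper bound. *)
Lemma support_funP y b : support_fun T y <= b <-> forall t, T t -> dot y t <= b.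
Proof.
have cdot : continuous (fun t : 'cV[R]_K => dot y t).
  have -> : (fun t : 'cV[R]_K => dot y t) = (fun t => \sum_i y i 0 * t i 0).
    by apply/funext => t; rewrite dotE.
  apply: continuous_big => [|i _ z]; first exact: add_continuous.
  apply: (@cvgM R 'cV[R]_K (nbhs z) _ (cst (y i 0)) (fun z => z i 0)).
    exact: cvg_cst.
  exact: coord_continuous.
have hs : has_sup [set dot y u | u in T].
  apply: compact_has_sup; first exact: image_nonempty.
  by apply: continuous_compact => //; exact: continuous_subspaceT.
split=> [le_b t Tt|le_b].
  by apply: le_trans le_b; apply: ub_le_sup; [case: hs|exists t].
by apply: ge_sup; [case: hs|move=> _ [t Tt <-]; exact: le_b].
Qed.

Lemma dot_le_support_fun y t : T t -> dot y t <= support_fun T y.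
Proof. by move: t; apply/support_funP. Qed.

(** An interior point can be lowered by a fixed amount in every coordinate without leaving [T],
    where coordinates are nonnegative. *)
Lemma interior_gt0 : exists2 e : R, 0 < e & exists2 t, T t & forall k, e <= t k 0.
Proof.
case: T_interior => t /nbhs_ballP[e /= e0 te].
have e2 : 0 < e / 2 by rewrite divr_gt0.
exists (e / 2) => //; exists t => [|k]; first by apply: te; exact: ballxx.
have /T_nonneg/(_ k) : T (t - const_mx (e / 2)).
  apply: te; split => // i j; rewrite /ball/= !mxE opprB addrC subrK.
  by rewrite gtr0_norm// ltr_pdivrMr// ltr_pMr// ltr1n.
by rewrite !mxE subr_ge0.
Qed.

Definition ellitope_mx (mu : 'cV[R]_K) : 'M[R]_n := \sum_k mu k 0 *: Tk k.

Lemma qform_ellitope_mx mu x :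
  qform (ellitope_mx mu) x = dot mu (\col_k qform (Tk k) x).
Proof.
rewrite qform_sum dotE; apply: eq_bigr => k _.
by rewrite qformZ mxE.
Qed.

Lemma ellitope_mx_sym mu : ellitope_mx mu \is symmetricmx.
Proof.
apply/symmetricP; rewrite /ellitope_mx linear_sum/=; apply: eq_bigr => k _.
by rewrite linearZ/= (symmetricP _ (Tk_psd k).1).
Qed.

Lemma qform_ellitope_le mu x : nonneg_vec mu -> ellitope Tk T x ->
  qform (ellitope_mx mu) x <= support_fun T mu.
Proof.
move=> mu0 [t Tt xt]; apply: le_trans (dot_le_support_fun _ Tt).
rewrite qform_ellitope_mx !dotE; apply: ler_sum => k _.
by rewrite ler_wpM2l// mxE.
Qed.

Context {r : nat} (r0 : (0 < r)%N).
Implicit Types G : 'M[R]_(r, n).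

(** The constraints of one index [l] for one of the two matrix inequalities, [G] being the stacked
    perturbation matrix or the bias matrix. *)
Definition lmi_feasible G (rho lambda : R) (mu : 'cV[R]_K) : Prop :=
  [/\ nonneg_vec mu, lambda + support_fun T mu <= rho &
      psdmx (half_block lambda G (ellitope_mx mu))].

Lemma lmi_feasibleP G rho lambda mu : lmi_feasible G rho lambda mu <->
  [/\ nonneg_vec mu, forall t, T t -> dot mu t <= rho - lambda &
      forall u x, 0 <= lambda * dot u u + dot u (G *m x) +
                       dot mu (\col_k qform (Tk k) x)].
Proof.
rewrite /lmi_feasible -lerBrDl; split=> -[mu0 tl psd]; split=> //.
- exact/support_funP.
- move=> u x; rewrite -qform_ellitope_mx.
  by move: u x; apply/psdmx_half_block => //; exact: ellitope_mx_sym.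
- exact/support_funP.
- apply/psdmx_half_block; first exact: ellitope_mx_sym.
  by move=> u x; rewrite qform_ellitope_mx.
Qed.

(** The norm bound at [x = 0] gives [0 <= lambda]; the support function is nonnegative because [mu]
    and [T] are. *)
Lemma lmi_feasible_bounds G rho lambda mu : lmi_feasible G rho lambda mu ->
  [/\ 0 <= lambda, 0 <= support_fun T mu & 0 <= rho].
Proof.
move=> [mu0 le_rho psd].
have l0 : 0 <= lambda.
  have := half_block_frob_norm 0 r0 psd.
  by rewrite mulmx0 frob_norm0 qformE /dot !mulmx0 mxE addr0.
have s0 : 0 <= support_fun T mu.
  case: T0 => t Tt; apply: le_trans (dot_le_support_fun mu Tt).
  by rewrite dotE; apply: sumr_ge0 => k _; exact: mulr_ge0 (mu0 k) (T_nonneg Tt k).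
by split=> //; apply: le_trans le_rho; rewrite addr_ge0.
Qed.

Lemma lmi_feasible_norm G rho lambda mu x : lmi_feasible G rho lambda mu ->
  ellitope Tk T x -> frob_norm (G *m x) <= rho.
Proof.
move=> [mu0 le_rho psd] Xx; apply: le_trans le_rho.
apply: le_trans (half_block_frob_norm x r0 psd) _.
by rewrite lerD2l qform_ellitope_le.
Qed.

Lemma lmi_feasibleW G rho rho' lambda mu : rho <= rho' ->
  lmi_feasible G rho lambda mu -> lmi_feasible G rho' lambda mu.
Proof. by move=> le_rho [mu0 le psd]; split => //; exact: le_trans le_rho. Qed.

(** Each inequality of [lmi_feasibleP] is linear and homogeneous jointly in [G], [rho], [lambda] and
    [mu], so the feasible tuples form a convex cone. *)
Lemma lmi_feasible_conv (a b : R) G1 rho1 lambda1 mu1 G2 rho2 lambda2 mu2 :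
  0 <= a -> 0 <= b ->
  lmi_feasible G1 rho1 lambda1 mu1 -> lmi_feasible G2 rho2 lambda2 mu2 ->
  lmi_feasible (a *: G1 + b *: G2) (a * rho1 + b * rho2)
    (a * lambda1 + b * lambda2) (a *: mu1 + b *: mu2).
Proof.
move=> a0 b0 /lmi_feasibleP[mu10 tl1 psd1] /lmi_feasibleP[mu20 tl2 psd2].
apply/lmi_feasibleP; split.
- by move=> k; rewrite !mxE addr_ge0// mulr_ge0.
- move=> t Tt; rewrite dotDl !dotZl.
  have := ler_wpM2l a0 (tl1 t Tt); have := ler_wpM2l b0 (tl2 t Tt); lra.
- move=> u x; rewrite dotDl !dotZl mulmxDl dotDr -!scalemxAl !dotZr.
  have := mulr_ge0 a0 (psd1 u x); have := mulr_ge0 b0 (psd2 u x); lra.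
Qed.

Lemma lmi_min_attained G : pdmx (\sum_(k < K) Tk k) ->
  exists rho lambda mu, lmi_feasible G rho lambda mu /\
    forall rho' lambda' mu', lmi_feasible G rho' lambda' mu' -> rho <= rho'.
Proof.
move=> Tk_pd; have [lambda1 psd1] := half_block_feasible G Tk_pd.
(* With all multipliers 1, the lower right block is the positive definite sum of the [Tk k]. *)
pose mu1 : 'cV[R]_K := const_mx 1; pose rho1 := lambda1 + support_fun T mu1.
have f1 : lmi_feasible G rho1 lambda1 mu1.
  split=> //; first by move=> k; rewrite mxE.
  by rewrite /ellitope_mx; under eq_bigr do rewrite mxE scale1r.
have [e e0 [t Tt et]] := interior_gt0.
(* All affine inequalities valid on the feasible set; since the feasible set
   is itself cut out by affine inequalities, they characterize it. *)
pose D : set (R * 'cV[R]_(1 + (1 + K))) := [set ac | forall rho lambda mu,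
  lmi_feasible G rho lambda mu -> 0 <= ac.1 + (encode rho lambda mu *m ac.2) 0 0].
have DP rho lambda mu : (forall ac, D ac ->
    0 <= ac.1 + (encode rho lambda mu *m ac.2) 0 0) <-> lmi_feasible G rho lambda mu.
  split=> [h|f ac]; last exact.
  apply/lmi_feasibleP; split.
  - move=> k; have := h (0, coeff 0 0 (delta_mx k 0)).
    have dotd (mu' : 'cV[R]_K) : dot mu' (delta_mx k 0) = mu' k 0.
      rewrite dotE (bigD1 k)//= mxE !eqxx mulr1 big1 ?addr0// => i /negPf ik.
      by rewrite mxE ik mulr0.
    rewrite encode_coeff !mulr0 !add0r dotd; apply=> ? ? mu' [mu'0 _ _] /=.
    by rewrite encode_coeff !mulr0 !add0r dotd.
  - move=> t' Tt'; have := h (0, coeff 1 (-1) (- t')).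
    have dotN (mu' : 'cV[R]_K) : dot mu' (- t') = - dot mu' t'.
      by rewrite -scaleN1r dotZr mulN1r.
    rewrite encode_coeff add0r mulr1 mulrN1 dotN subr_ge0; apply=> ? ? mu'.
    move=> /lmi_feasibleP[_ /(_ t' Tt') + _].
    by rewrite encode_coeff add0r mulr1 mulrN1 dotN subr_ge0.
  - move=> u x.
    have := h (dot u (G *m x), coeff 0 (dot u u) (\col_k qform (Tk k) x)).
    rewrite encode_coeff mulr0 add0r addrA [dot _ _ + _]addrC; apply=> ? ? mu'.
    move=> /lmi_feasibleP[_ _ /(_ u x)].
    by rewrite encode_coeff mulr0 add0r addrA [dot _ _ + _]addrC.
have encrho rho lambda mu : (encode rho lambda mu *m coeff 1 0 0) 0 0 = rho.
  by rewrite encode_coeff mulr1 mulr0 addr0 /dot mulmx0 mxE addr0.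
(* The box: when [rho <= rho1], nonnegativity of the support function gives [lambda <= rho1], and
   nonnegativity of [lambda] gives [e * mu k <= dot mu t <= rho1]. *)
have [||z Zz zmin] := @affine_min_attained R _ _ D fst snd
  (Num.max rho1 (rho1 / e)) (coeff 1 0 0) (encode rho1 lambda1 mu1).
- exact/DP.
- move=> z; have [rho [lambda [mu ->]]] := encode_surj z => /DP f.
  rewrite !encrho => le_rho1 j.
  have [l0 s0 rho0] := lmi_feasible_bounds f; have [mu0 le_rho _] := f.
  apply: encode_bound.
  + by rewrite rho0 le_max le_rho1.
  + by rewrite l0 le_max; apply/orP; left; apply: le_trans le_rho1; lra.
  + move=> k; rewrite mu0 le_max; apply/orP; right; rewrite ler_pdivlMr//.
    have : mu k 0 * e <= dot mu t.
      rewrite dotE (bigD1 k)//=; apply: (@le_trans _ _ (mu k 0 * t k 0)).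
        by rewrite ler_wpM2l.
      by rewrite lerDl; apply: sumr_ge0 => i _; exact: mulr_ge0 (mu0 i) (T_nonneg Tt i).
    have := dot_le_support_fun mu Tt; lra.
have [rho [lambda [mu zE]]] := encode_surj z.
rewrite {}zE in Zz zmin; exists rho, lambda, mu; split; first exact/DP.
by move=> rho' lambda' mu' /DP/zmin; rewrite !encrho.
Qed.

End LmiProblem.

(** * The linear estimate *)

Section UnionBound.
Context {R : realType} {d : measure_display} {Omega : measurableType d}
  (P : probability Omega R).

Lemma probability_bigsetU_le (I : Type) (s : seq I) (A : I -> set Omega) :
  (forall i, measurable (A i)) ->
  (P (\big[setU/set0]_(i <- s) A i) <= \sum_(i <- s) P (A i))%E.
Proof.
move=> mA; elim: s => [|i s IH]; first by rewrite !big_nil measure0.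
rewrite !big_cons; apply: le_trans (measureU2 _ _ _) _ => //.
  by apply: bigsetU_measurable => j _; exact: mA.
by rewrite leeD2l.
Qed.

Lemma measurable_bigmaxr (I : Type) (s : seq I) (f : I -> Omega -> R) (c : R) :
  (forall i, measurable_fun setT (f i)) ->
  measurable_fun setT (fun w => \big[Num.max/c]_(i <- s) f i w).
Proof.
move=> mf; elim: s => [|i s IH].
  by under eq_fun do rewrite big_nil; exact: measurable_cst.
by under eq_fun do rewrite big_cons; exact: measurable_maxr.
Qed.

End UnionBound.

(** * Algebra of the estimation error *)

Section Estimate.
Context {R : realType} {m n nu q L K : nat}.
Context (A : 'M[R]_(m, n)) (dA : 'I_q -> 'M[R]_(m, n)) (B : 'M[R]_(nu, n)).
Context (Rl : 'I_L -> 'M[R]_nu) (Rl_psd : forall l, psdmx (Rl l)).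
Implicit Types (H : 'M[R]_(m, nu)) (x : 'cV[R]_n).

Definition bias_mx H l : 'M[R]_(nu, n) := sqrtmx (Rl l) *m (B - H^T *m A).

Definition pert_mx H l : 'M[R]_(\sum_(a < q) nu, n) :=
  \mxcol_(a < q) (sqrtmx (Rl l) *m H^T *m dA a).

(** For a fixed signal [x], the matrix through which [eta] enters the weighted error. *)
Definition signal_pert_mx H l x : 'M[R]_(nu, q) :=
  \matrix_(i, a) (sqrtmx (Rl l) *m H^T *m dA a *m x) i 0.

Lemma bias_lmiE (Tk : 'I_K -> 'M[R]_n) H l kappa chi :
  bias_lmi A B Rl Tk H l kappa chi =
  half_block kappa (bias_mx H l) (ellitope_mx Tk chi).
Proof. by rewrite /half_block trmx_mul (tr_sqrtmx (Rl_psd l)). Qed.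

Lemma perturbation_lmiE (Tk : 'I_K -> 'M[R]_n) H l lambda mu :
  perturbation_lmi dA Rl Tk H l lambda mu =
  half_block lambda (pert_mx H l) (ellitope_mx Tk mu).
Proof.
rewrite /perturbation_lmi /half_block tr_mxcol; congr (block_mx _ _ (_ *: _) _).
by apply: eq_mxrow => a; rewrite !trmx_mul trmxK (tr_sqrtmx (Rl_psd l)) mulmxA.
Qed.

(** The bias is affine in [H], with constant term from [B], hence the condition [a + b = 1]. *)
Lemma bias_mx_conv (a b : R) H1 H2 l : a + b = 1 ->
  bias_mx (a *: H1 + b *: H2) l = a *: bias_mx H1 l + b *: bias_mx H2 l.
Proof.
move=> ab1; rewrite /bias_mx !scalemxAr -mulmxDr; congr (_ *m _).
rewrite linearD/= !linearZ/= mulmxDl -!scalemxAl !scalerBr addrACA -scalerDl ab1.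
by rewrite scale1r opprD.
Qed.

Lemma pert_mx_conv (a b : R) H1 H2 l :
  pert_mx (a *: H1 + b *: H2) l = a *: pert_mx H1 l + b *: pert_mx H2 l.
Proof.
apply/mxcolP => i; rewrite mxcolK submxcolD.
have submxcolZ c (M : 'M[R]_(\sum_(a < q) nu, n)) :
    submxcol (c *: M) i = c *: submxcol M i.
  by apply/matrixP => j k; rewrite !mxE.
rewrite !submxcolZ !mxcolK linearD/= !linearZ/= mulmxDr mulmxDl.
by rewrite -!scalemxAr -!scalemxAl.
Qed.

(** Both sides have the same entries, arranged as a matrix or stacked in one column. This lets the
    matrix inequality, which controls the stacked vector, feed the tail bound, which needs a
    Frobenius norm. *)
Lemma frob_signal_pert_mx H l x :
  frob_norm (signal_pert_mx H l x) = frob_norm (pert_mx H l *m x).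
Proof.
apply/eqP; rewrite -(eqrXn2 (n := 2)) ?frob_norm_ge0// -dot_frob sqr_frob_norm.
rewrite /pert_mx mxcol_mul /dot tr_mxcol mul_mxrow_mxcol summxE exchange_big/=.
apply/eqP; apply: eq_bigr => a _; rewrite -/(dot _ _) dotE.
by apply: eq_bigr => i _; rewrite mxE expr2.
Qed.

Lemma signal_pert_mx_mul H l x (e : 'cV[R]_q) :
  signal_pert_mx H l x *m e =
  sqrtmx (Rl l) *m H^T *m (\sum_a e a 0 *: dA a) *m x.
Proof.
rewrite mulmx_sumr mulmx_suml; apply/colP => i; rewrite summxE !mxE.
apply: eq_bigr => a _; rewrite -scalemxAr -scalemxAl !mxE mulrC.
by congr (_ * _); rewrite mxE.
Qed.

Lemma estimation_error H l x (e : 'cV[R]_q) (z : 'cV[R]_m) :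
  sqrtmx (Rl l) *m (B *m x - H^T *m (perturbed_mx A dA e *m x + z)) =
  bias_mx H l *m x - signal_pert_mx H l x *m e - sqrtmx (Rl l) *m H^T *m z.
Proof.
rewrite signal_pert_mx_mul /bias_mx /perturbed_mx -!mulmxA -!mulmxBr.
by congr (_ *m _); rewrite mulmxBl -mulmxA mulmxDl !mulmxDr !opprD !addrA.
Qed.

Lemma frob_normB3 k (u v w : 'cV[R]_k) :
  frob_norm (u - v - w) <= frob_norm u + frob_norm v + frob_norm w.
Proof.
have normN (z : 'cV[R]_k) : frob_norm (- z) = frob_norm z.
  by rewrite -scaleN1r frob_normZ normrN1 mul1r.
apply: le_trans (frob_normD _ _) _; rewrite normN lerD2r.
by apply: le_trans (frob_normD _ _) _; rewrite normN.
Qed.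

End Estimate.

(** * Attainment, convexity and the risk bound *)

Section Risk.
Context {R : realType} {m n nu q L K : nat}.
Context (hnu : (0 < nu)%N) (hq : (0 < q)%N) (hL : (0 < L)%N).
Context (A : 'M[R]_(m, n)) (dA : 'I_q -> 'M[R]_(m, n)) (B : 'M[R]_(nu, n)).
Context (Rl : 'I_L -> 'M[R]_nu) (Rl_psd : forall l, psdmx (Rl l)).
Context (Tk : 'I_K -> 'M[R]_n) (Tk_psd : forall k, psdmx (Tk k))
  (Tk_pd : pdmx (\sum_(k < K) Tk k)).
Context (T : set 'cV[R]_K) (T_nonneg : forall t, T t -> nonneg_vec t)
  (T_compact : compact T) (T_interior : interior T !=set0).
Context (sigma : R) (sigma_gt0 : 0 < sigma) (eps : R) (eps_gt0 : 0 < eps)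
  (eps_lt1 : eps < 1).
Implicit Types (H : 'M[R]_(m, nu)) (x : 'cV[R]_n).

Let nuq_gt0 : (0 < \sum_(a < q) nu)%N.
Proof. by rewrite sum_nat_const card_ord muln_gt0 hq. Qed.

Let c := 1 + Num.sqrt (2 * ln (2 * L%:R / eps)).

Let c_gt0 : 0 < c.
Proof. by rewrite ltr_pwDl// sqrtr_ge0. Qed.

Let maxfrob H : R := \big[Num.max/0]_(l < L) frob_norm (H *m sqrtmx (Rl l)).

Lemma feasibleE H lambda kappa mu chi rho varrho :
  feasible A dA B Rl Tk T H lambda kappa mu chi rho varrho <->
  forall l, lmi_feasible Tk T (pert_mx dA Rl H l) rho (lambda l) (mu l) /\
            lmi_feasible Tk T (bias_mx A B Rl H l) varrho (kappa l) (chi l).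
Proof.
split=> f l; have := f l; rewrite perturbation_lmiE// bias_lmiE//.
  by move=> [[]].
by move=> [[]] ? ? ? [].
Qed.

(** The problems for different [l] and for the two matrix inequalities are coupled only through
    [rho] and [varrho]. Each is minimized separately and the maxima over [l] are taken; the
    objective increases in both. *)
Lemma objective_attained H :
  exists2 v, objective_values A dA B Rl Tk T sigma eps H v &
    lbound (objective_values A dA B Rl Tk T sigma eps H) v.
Proof.
have /choice[r1 h1] l := lmi_min_attained Tk_psd T_nonneg T_compact T_interior
  nuq_gt0 (pert_mx dA Rl H l) Tk_pd.
have /choice[la1 h2] := h1; have /choice[mu1 {h1 h2}h1] := h2.
have /choice[r2 h2] l := lmi_min_attained Tk_psd T_nonneg T_compact T_interior
  hnu (bias_mx A B Rl H l) Tk_pd.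
have /choice[la2 h3] := h2; have /choice[mu2 {h2 h3}h2] := h3.
pose rho := \big[Num.max/0]_(l < L) r1 l; pose varrho := \big[Num.max/0]_(l < L) r2 l.
exists (objective Rl sigma eps H rho varrho).
  exists la1, la2, mu1, mu2, rho, varrho; split=> //; apply/feasibleE => l.
  by split; [apply: lmi_feasibleW (h1 l).1|apply: lmi_feasibleW (h2 l).1];
    exact: le_bigmax.
move=> _ [lambda [kappa [mu [chi [rho' [varrho' [/feasibleE f ->]]]]]]].
(* Any one index shows that the competing [rho'] and [varrho'] are nonnegative, as required because
   the maxima start at 0. *)
have [f1 f2] := f (Ordinal hL).
have [_ _ rho'0] := lmi_feasible_bounds T_nonneg T_compact T_interior nuq_gt0 f1.
have [_ _ varrho'0] := lmi_feasible_bounds T_nonneg T_compact T_interior hnu f2.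
apply: lerD; last first.
  by apply: bigmax_le => // l _; apply: (h2 l).2 (f l).2.
rewrite ler_pM2l// lerD2l.
by apply: bigmax_le => // l _; apply: (h1 l).2 (f l).1.
Qed.

Lemma objective_conv (a b : R) H1 H2 rho1 rho2 varrho1 varrho2 :
  0 <= a -> 0 <= b ->
  objective Rl sigma eps (a *: H1 + b *: H2)
    (a * rho1 + b * rho2) (a * varrho1 + b * varrho2) <=
  a * objective Rl sigma eps H1 rho1 varrho1 +
  b * objective Rl sigma eps H2 rho2 varrho2.
Proof.
move=> a0 b0; rewrite /objective -/c -!/(maxfrob _).
(* The terms in [rho] and [varrho] agree on both sides; only the Frobenius part is genuinely
   convex. *)
suff : c * (sigma * maxfrob (a *: H1 + b *: H2)) <=
    c * (sigma * (a * maxfrob H1 + b * maxfrob H2)) by nra.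
rewrite !ler_pM2l//.
have M0 H : 0 <= maxfrob H by exact: bigmax_ge_id.
apply: bigmax_le => [|l _]; first by rewrite addr_ge0// mulr_ge0.
rewrite mulmxDl -!scalemxAl; apply: le_trans (frob_normD _ _) _.
rewrite !frob_normZ !ger0_norm//.
by apply: lerD; rewrite ler_wpM2l//;
  exact: (le_bigmax _ (fun l => frob_norm (_ *m sqrtmx (Rl l)))).
Qed.

Lemma objective_values_conv (a b : R) H1 H2 v1 v2 :
  0 <= a -> 0 <= b -> a + b = 1 ->
  objective_values A dA B Rl Tk T sigma eps H1 v1 ->
  objective_values A dA B Rl Tk T sigma eps H2 v2 ->
  exists2 v, objective_values A dA B Rl Tk T sigma eps (a *: H1 + b *: H2) v &
    v <= a * v1 + b * v2.
Proof.
move=> a0 b0 ab1 [la1 [ka1 [mu1 [chi1 [rho1 [varrho1 [/feasibleE f1 ->]]]]]]].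
move=> [la2 [ka2 [mu2 [chi2 [rho2 [varrho2 [/feasibleE f2 ->]]]]]]].
exists (objective Rl sigma eps (a *: H1 + b *: H2)
    (a * rho1 + b * rho2) (a * varrho1 + b * varrho2)); last exact: objective_conv.
exists (fun l => a * la1 l + b * la2 l), (fun l => a * ka1 l + b * ka2 l).
exists (fun l => a *: mu1 l + b *: mu2 l), (fun l => a *: chi1 l + b *: chi2 l).
exists (a * rho1 + b * rho2), (a * varrho1 + b * varrho2); split=> //.
apply/feasibleE => l; have [p1 b1] := f1 l; have [p2 b2] := f2 l.
by rewrite pert_mx_conv bias_mx_conv//; split; exact: lmi_feasible_conv.
Qed.

Context {d : measure_display} {Omega : measurableType d}
  (P : probability Omega R) (xi : 'I_m -> {RV P >-> R}) (eta : 'I_q -> {RV P >-> R}).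
Context (xi_subgaussian : zero_mean_subgaussian sigma xi)
  (eta_subgaussian : zero_mean_subgaussian 1 eta).

Lemma error_tail H lambda kappa mu chi rho varrho x :
  feasible A dA B Rl Tk T H lambda kappa mu chi rho varrho ->
  ellitope Tk T x ->
  (P [set w | (objective Rl sigma eps H rho varrho <
     maxnorm Rl (B *m x -
       H^T *m (perturbed_mx A dA (rvec eta w) *m x + rvec xi w)))%R] <= eps%:E)%E.
Proof.
move=> /feasibleE f Xx.
(* There are two bad events for each of the [L] indices, and [delta^-1] is the argument of the
   logarithm in the objective. *)
pose delta := eps / (2 * L%:R).
have L0 : (0 : R) < L%:R by rewrite ltr0n.
have delta0 : 0 < delta by rewrite divr_gt0// mulr_gt0.
have delta1 : delta <= 1.
  rewrite ler_pdivrMr ?mulr_gt0// mul1r (le_trans (ltW eps_lt1))//.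
  by rewrite -natrM ler1n muln_gt0.
have cE : c = 1 + Num.sqrt (2 * ln delta^-1) by rewrite invf_div.
pose SH l := sqrtmx (Rl l) *m H^T; pose W l := signal_pert_mx dA Rl H l x.
pose E1 l := [set w | c * (sigma * frob_norm (SH l)) < frob_norm (SH l *m rvec xi w)].
pose E2 l := [set w | c * (1 * frob_norm (W l)) < frob_norm (W l *m rvec eta w)].
have mE1 l : measurable (E1 l).
  apply: measurable_gt_cst; apply: measurable_frob_norm => i.
  exact: measurable_rvec_mul.
have mE2 l : measurable (E2 l).
  apply: measurable_gt_cst; apply: measurable_frob_norm => i.
  exact: measurable_rvec_mul.
pose err w := B *m x - H^T *m (perturbed_mx A dA (rvec eta w) *m x + rvec xi w).
have errE l w : Num.sqrt (qform (Rl l) (err w)) =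
    frob_norm (bias_mx A B Rl H l *m x - W l *m rvec eta w - SH l *m rvec xi w).
  by rewrite sqrt_qform// estimation_error.
have [f1 f2] := f (Ordinal hL).
have [_ _ rho0] := lmi_feasible_bounds T_nonneg T_compact T_interior nuq_gt0 f1.
have [_ _ varrho0] := lmi_feasible_bounds T_nonneg T_compact T_interior hnu f2.
have maxfrob0 : 0 <= maxfrob H by exact: bigmax_ge_id.
have sub : [set w | objective Rl sigma eps H rho varrho < maxnorm Rl (err w)] `<=`
    \big[setU/set0]_(l < L) (E1 l `|` E2 l).
  move=> w /=; apply: contraPP => notE; apply/negP; rewrite -leNgt.
  have notE12 l : ~ E1 l w /\ ~ E2 l w.
    apply/not_orP => El; apply: notE.
    by rewrite -bigcup_seq; exists l => //=; rewrite mem_index_enum.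
  (* As [maxnorm] starts at 0, the objective must also be shown nonnegative. *)
  apply: bigmax_le => [|l _].
    by rewrite addr_ge0// mulr_ge0 ?(ltW c_gt0)// addr_ge0// mulr_ge0// ltW.
  rewrite errE; apply: le_trans (frob_normB3 _ _ _) _.
  have [/negP + /negP] := notE12 l; rewrite -!leNgt mul1r => e1 e2.
  have [fp fb] := f l.
  have n1 := lmi_feasible_norm T_compact T_interior nuq_gt0 fp Xx.
  have n2 := lmi_feasible_norm T_compact T_interior hnu fb Xx.
  rewrite frob_signal_pert_mx in e2.
  (* [SH l] is the transpose of [H *m sqrtmx (Rl l)], so the two Frobenius norms agree. *)
  have SHle : frob_norm (SH l) <= maxfrob H.
    rewrite -frob_norm_tr trmx_mul trmxK tr_sqrtmx//.
    exact: (le_bigmax _ (fun l => frob_norm (H *m sqrtmx (Rl l)))).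
  rewrite /objective -/c -/(maxfrob H) mulrDr.
  have e1' : c * (sigma * frob_norm (SH l)) <= c * (sigma * maxfrob H).
    by rewrite !ler_pM2l.
  have e2' : c * frob_norm (pert_mx dA Rl H l *m x) <= c * rho.
    by rewrite ler_pM2l.
  lra.
have merr : measurable_fun setT (fun w => maxnorm Rl (err w)).
  apply: measurable_bigmaxr => l; under eq_fun do rewrite errE.
  have colB3 (u v w : 'cV[R]_nu) i : (u - v - w) i 0 = u i 0 - v i 0 - w i 0.
    by rewrite !mxE.
  apply: measurable_frob_norm => i; under eq_fun do rewrite colB3.
  by apply: measurable_funB; [apply: measurable_funB => //|]; exact: measurable_rvec_mul.
apply: le_trans (le_measure _ _ _ sub) _.
- by rewrite inE; exact: measurable_gt_cst.
- by rewrite inE; apply: bigsetU_measurable => l _; exact: measurableU.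
apply: le_trans (probability_bigsetU_le _ _ _) _ => [l|]; first exact: measurableU.
apply: (@le_trans _ _ (\sum_(l < L) (delta + delta)%:E)%E).
  apply: lee_sum => l _; apply: le_trans (measureU2 _ _ _) _ => //.
  by rewrite EFinD; apply: leeD; rewrite /E1 /E2 cE; exact: subgaussian_frob_tail.
rewrite sumEFin lee_fin sumr_const card_ord -mulr_natr /delta.
by rewrite le_eqVlt; apply/orP; left; apply/eqP; field; rewrite gt_eqF.
Qed.

End Risk.

Theorem proposition2p1 (R : realType) (m n nu q L K : nat)
  (hnu : (0 < nu)%N) (hq : (0 < q)%N) (hL : (0 < L)%N)
  (A : 'M[R]_(m, n)) (dA : 'I_q -> 'M[R]_(m, n)) (B : 'M[R]_(nu, n))
  (Rl : 'I_L -> 'M[R]_nu)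
  (Rl_psd : forall l, psdmx (Rl l)) (Rl_pd : pdmx (\sum_(l < L) Rl l))
  (Tk : 'I_K -> 'M[R]_n)
  (Tk_psd : forall k, psdmx (Tk k)) (Tk_pd : pdmx (\sum_(k < K) Tk k))
  (T : set 'cV[R]_K)
  (T_nonneg : forall t, T t -> nonneg_vec t)
  (T_convex : convex_set T) (T_compact : compact T)
  (T_interior : interior T !=set0)
  (T_monotone : forall t' t, T t -> nonneg_vec t' ->
     (forall k, t' k 0 <= t k 0) -> T t')
  (sigma : R) (sigma_gt0 : 0 < sigma)
  (eps : R) (eps_gt0 : 0 < eps) (eps_lt1 : eps < 1)
  (d : measure_display) (Omega : measurableType d) (P : probability Omega R)
  (xi : 'I_m -> {RV P >-> R}) (eta : 'I_q -> {RV P >-> R})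
  (xi_subgaussian : zero_mean_subgaussian sigma xi)
  (eta_subgaussian : zero_mean_subgaussian 1 eta) :
  let frakR := risk_bound A dA B Rl Tk T sigma eps in
  let obs x w := perturbed_mx A dA (rvec eta w) *m x + rvec xi w in
  [/\ (* the minimum defining frakR H is attained *)
      forall H, let S := objective_values A dA B Rl Tk T sigma eps H in
        (S `&` lbound S) (frakR H),
      convex_function [set: 'M[R]_(m, nu)] frakR &
      forall H : 'M[R]_(m, nu),
        (eps_risk P (maxnorm Rl) eps (ellitope Tk T) B obs
           (fun omega => H^T *m omega)
         <= (frakR H)%:E)%E].
Proof.
move=> frakR obs.
have attained H : let S := objective_values A dA B Rl Tk T sigma eps H in
    (S `&` lbound S) (frakR H).
  move=> S; have [v Sv lbv] := objective_attained hnu hq hL A dA B Rl_psd Tk_psd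
    Tk_pd T_nonneg T_compact T_interior sigma eps H.
  have -> : frakR H = v.
    apply/eqP; rewrite eq_le; apply/andP; split.
      by apply: ge_inf => //; exists v.
    by apply: lb_le_inf => //; exists v.
  by split.
split=> // [t H1 H2 _ _|H].
  have [S1 _] := attained H1; have [S2 _] := attained H2.
  have t0 : 0 <= t%:num by [].
  have t1 : 0 <= 1 - t%:num by rewrite subr_ge0.
  have [v Sv le_v] := objective_values_conv Rl_psd Tk_psd T_compact T_interior
    sigma_gt0 t0 t1 (subrKC _ _) S1 S2.
  apply: le_trans le_v.
  by have [_] := attained (t%:num *: H1 + (1 - t%:num) *: H2); exact.
(* A minimizing tuple represents [frakR H] as an objective value; [error_tail] then makes it an
   admissible level for every signal, so it dominates each inner infimum. *)
have [[la [ka [mu [chi [rho [varrho [f ->]]]]]]] _] := attained H.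
apply: ge_ereal_sup => _ [x Xx <-].
apply: ereal_inf_lbound; exists (objective Rl sigma eps H rho varrho) => //=.
exact: (error_tail hnu hq hL Rl_psd T_nonneg T_compact T_interior
  sigma_gt0 eps_gt0 eps_lt1 xi_subgaussian eta_subgaussian f).
Qed.
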